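(* Let $P=(X,\prec)$ be a finite poset and let $x,y\in X$ be fixed elements. Let $f$ be a uniformly random linear extension of $P$, with $\mathbb{E}$ denoting expectation with respect to $f$. Then $$\frac{\mathbb{E}[f(x)\,f(y)]+\mathbb{E}\big[\min\{f(x),f(y)\}\big]}{\mathbb{E}[f(x)]\cdot\mathbb{E}[f(y)]}\ \le\ 2.$$
   Context: A linear extension of a poset $P=(X,\prec)$ with $|X|=n$ is a bijection $f:X\to\{1,\dots,n\}$ such that $u\prec v$ implies $f(u)<f(v)$. The random linear extension $f$ is chosen uniformly from the set of all linear extensions of $P$. *)

(* Defs.v *)
From HB Require Import structures.
From mathcomp Require Import all_boot all_order all_algebra.
Set Implicit Arguments.
Unset Strict Implicit.
Unset Printing Implicit Defensive.
Import Order.TTheory GRing.Theory Num.Theory.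
Local Open Scope ring_scope.

(* The bijection X -> {1, .., n} is stored 0-based, as a finite function       *)
(* g : X -> 'I_n; the actual value of the linear extension at x is            *)
(* lext_val g x = (g x).+1, in {1, .., n}.                                    *)
Definition linear_extension (d : Order.disp_t) (X : finPOrderType d)
    (g : {ffun X -> 'I_#|X|}) : bool :=
  [&& injectiveb g,
      [forall i : 'I_#|X|, exists u : X, g u == i] &
      [forall u : X, forall v : X, (u < v)%O ==> (g u < g v)%N]].

Definition linear_extensions (d : Order.disp_t) (X : finPOrderType d) :
    {set {ffun X -> 'I_#|X|}} :=
  [set g | linear_extension g].

Definition lext_val (d : Order.disp_t) (X : finPOrderType d)
    (g : {ffun X -> 'I_#|X|}) (x : X) : nat := (g x).+1.

Definition lext_expect (R : realFieldType) (d : Order.disp_t)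
    (X : finPOrderType d) (F : {ffun X -> 'I_#|X|} -> R) : R :=
  (\sum_(g in linear_extensions X) F g) / #|linear_extensions X|%:R.

(* Main.v *)
Require Import Defs.
From HB Require Import structures.
From mathcomp Require Import all_boot all_order all_algebra.
From mathcomp Require Import zify ring lra.
Set Implicit Arguments.
Unset Strict Implicit.
Unset Printing Implicit Defensive.
Local Open Scope nat_scope.

(** Summing [2uv(ab + min(a,b)) <= v^2 a(a+1) + u^2 b(b+1)] over all linear
    extensions, with [a = f(x)], [b = f(y)], [u = E f(x)], [v = E f(y)], reduces
    the theorem to the case [x = y], that is, to [E C(f(x)+1, 2) <= (E f(x))^2].

    For an up-set [A] containing [x] let [e(A)], [h(A)], [g(A)] be the sums of
    [1], [f(x)], [C(f(x)+1, 2)] over the linear extensions of [A]. Splitting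
    according to the first element [m] gives
    [h(A) = e(A) + sum_(m != x) h(A - m)] and
    [g(A) = h(A) + sum_(m != x) g(A - m)], so [g(A) e(A) <= h(A)^2] follows by
    induction as soon as the mean [h/e] does not increase when a minimal element
    is deleted. As [h(A)] counts the linear extensions of [A] with a new element
    [z] added below [x], this is the inequality
    [e(S - m) e(S - z) <= e(S) e(S - m - z)] with [S = A + z], a weak form of
    Fishburn's inequality. The order polynomials of the four up-sets satisfy the
    same inequality by the four functions theorem, and [e] is recovered from
    their growth. *)

(** * The four functions theorem on the subsets of a finite set *)

Section FourFunctions.

Variable T : finType.
Implicit Types (a b c d : {set T} -> nat) (U V E : {set T}).

(** One-point case of the four functions theorem. Put [r = a0 * b1], [t = a1 * b0], [w = c1 * d0],
    [q = c0 * d1]: since [r, t <= w], expanding [(w - r)(w - t) >= 0] and using [r * t <= w * q]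
    gives [w(r + t) <= w(w + q)]; if [w = 0] then [r = t = 0]. *)
Lemma four_numbers (a0 a1 b0 b1 c0 c1 d0 d1 : nat) :
    a0 * b0 <= c0 * d0 -> a0 * b1 <= c1 * d0 ->
    a1 * b0 <= c1 * d0 -> a1 * b1 <= c1 * d1 ->
  (a0 + a1) * (b0 + b1) <= (c0 + c1) * (d0 + d1).
Proof.
move=> h00 h01 h10 h11.
suff: a0 * b1 + a1 * b0 <= c1 * d0 + c0 * d1 by nia.
have hm: (a0 * b1) * (a1 * b0) <= (c1 * d0) * (c0 * d1).
  have -> : (a0 * b1) * (a1 * b0) = (a0 * b0) * (a1 * b1) by nia.
  have -> : (c1 * d0) * (c0 * d1) = (c0 * d0) * (c1 * d1) by nia.
  exact: leq_mul.
move: (a0 * b1) (a1 * b0) (c1 * d0) (c0 * d1) h01 h10 hm => r t w q; nia.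
Qed.

Lemma sum_subsetU1 (x : T) E (F : {set T} -> nat) : x \notin E ->
  \sum_(U : {set T} | U \subset x |: E) F U =
  \sum_(U : {set T} | U \subset E) (F U + F (x |: U)).
Proof.
move=> xE; rewrite big_split /= (bigID (fun U : {set T} => x \in U)) /= addnC.
congr (_ + _).
  apply: eq_bigl => U; apply/andP/idP => [[UE xU]|UE].
    by rewrite -(setU1K xE) subsetD1 UE.
  split; first by apply: subset_trans UE _; apply: subsetUr.
  by apply: contra xE; apply: (subsetP UE).
rewrite (reindex_onto (fun U => x |: U) (fun U => U :\ x)) /=; last first.
  by move=> U /andP[_ xU]; rewrite setD1K.
apply: eq_bigl => U; rewrite setU11 andbT; apply/andP/idP => [[UE /eqP <-]|UE].
  by rewrite -(setU1K xE) setSD.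
have xU: x \notin U by apply: contra xE; apply: (subsetP UE).
by rewrite setUS // setU1K.
Qed.

(* The Ahlswede--Daykin inequality. *)
Theorem four_functions a b c d E :
    (forall U V, U \subset E -> V \subset E ->
       a U * b V <= c (U :|: V) * d (U :&: V)) ->
  (\sum_(U : {set T} | U \subset E) a U) * (\sum_(U : {set T} | U \subset E) b U)
  <= (\sum_(U : {set T} | U \subset E) c U) *
     (\sum_(U : {set T} | U \subset E) d U).
Proof.
move: {2}#|E| (erefl #|E|) => n; elim: n E a b c d => [|n IHn] E a b c d cE abcd.
  have E0 : E = set0 by apply/eqP; rewrite -cards_eq0 cE.
  have sum0 F : \sum_(U : {set T} | U \subset E) F U = F set0.
    by rewrite E0 (eq_bigl (fun U => U == set0)) ?big_pred1_eq // => U; rewrite subset0.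
  have := abcd set0 set0 (sub0set _) (sub0set _).
  by rewrite setU0 setI0 !sum0.
have /card_gt0P[x xE] : 0 < #|E| by rewrite cE.
(* Each function is folded along [x] into [U |-> F U + F (x |: U)] on the subsets of [E :\ x]; the
   folded functions satisfy the hypothesis by [four_numbers]. *)
rewrite -(setD1K xE) !sum_subsetU1 ?setD11 //.
apply: IHn => [|U V UE VE]; first by move: cE; rewrite (cardsD1 x) xE; case.
have xU: x \notin U by apply/negP => /(subsetP UE); rewrite setD11.
have xV: x \notin V by apply/negP => /(subsetP VE); rewrite setD11.
have sU: U \subset E by apply: subset_trans UE (subD1set _ _).
have sV: V \subset E by apply: subset_trans VE (subD1set _ _).
have sxU: x |: U \subset E by rewrite subUset sub1set xE.
have sxV: x |: V \subset E by rewrite subUset sub1set xE.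
apply: four_numbers; first exact: abcd.
- have := abcd _ _ sU sxV; rewrite setUCA setIUr.
  suff -> : U :&: [set x] = set0 by rewrite set0U.
  by apply/eqP; rewrite setI_eq0 disjoint_sym disjoints1.
- have := abcd _ _ sxU sV; rewrite -setUA setIUl.
  suff -> : [set x] :&: V = set0 by rewrite set0U.
  by apply/eqP; rewrite setI_eq0 disjoints1.
- by have := abcd _ _ sxU sxV; rewrite setUACA setUid -setUIr.
Qed.

End FourFunctions.

(** * Comparison of binomial coefficients with powers *)

Lemma ffact_leq_exp n m : n ^_ m <= n ^ m.
Proof.
elim: m n => [|m IHm] [|n] //; rewrite ?ffact0n // ffactSS expnS leq_mul //.
by apply: leq_trans (IHm n) _; case: m {IHm} => // m; rewrite leq_exp2r.
Qed.

Lemma exp_leq_ffact n m : n ^ m <= (n + m) ^_ m.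
Proof.
elim: m => [|m IHm] //; rewrite addnS ffactSS expnS leq_mul //.
by lia.
Qed.

(** The mean value bound for [t ^ j.+1] on [[M, M + b]], with the derivative taken at the right
    end. *)
Lemma expnD_leq M b j :
  (M + b) ^ j.+1 <= M ^ j.+1 + j.+1 * b * (M + b) ^ j.
Proof.
elim: j => [|j IHj]; first by rewrite !expn1 expn0; lia.
rewrite expnS mulnDl.
have h : M * (M + b) ^ j <= (M + b) ^ j.+1 by rewrite expnS leq_mul2r leq_addr orbT.
move: IHj h; rewrite (expnS M j.+1).
move: ((M + b) ^ j.+1) ((M + b) ^ j) (M ^ j.+1) => u v w hu hv.
have := leq_mul (leqnn M) hu; have := leq_mul (leqnn (j.+1 * b)) hv; nia.
Qed.

(* The ratio of the two sides tends to (k + 1) / (k + 2) as N grows. *)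
Lemma bin_mul_leq_sqr k : exists N,
  0 < 'C(N, k.+1) /\
  'C(N + k.+1, k.+2) * 'C(N + k - 1, k) <= 'C(N, k.+1) * 'C(N, k.+1).
Proof.
(* With [K = M + 2(k+1)], replacing [K^(2k+2)] by [M^(2k+2)] loses at most [(2k+2)^2 K^(2k+1)] by
   [expnD_leq]. This [M] makes the loss at most [K^(2k+2) / (k+2)]; the remaining factor
   [(k+1)/(k+2)] is the factorial quotient [(k+1)!^2 / (k! (k+2)!)]. *)
pose M := k.+2 * (2 * k.+1) ^ 2.
exists (M + k.+1); split; first by rewrite bin_gt0 leq_addl.
set K := M + 2 * k.+1.
have h1 : 'C(M + k.+1 + k.+1, k.+2) * (k.+2)`! <= K ^ k.+2.
  by rewrite bin_ffact -addnA addnn -mul2n ffact_leq_exp.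
have h2 : 'C(M + k.+1 + k - 1, k) * k`! <= K ^ k.
  rewrite bin_ffact; apply: leq_trans (ffact_leq_exp _ _) _.
  have [->|k0] := posnP k; first by [].
  by rewrite leq_exp2r // /K; lia.
have h3 : M ^ k.+1 <= 'C(M + k.+1, k.+1) * (k.+1)`!.
  by rewrite bin_ffact exp_leq_ffact.
have h4 : k.+1 * (K ^ k.+2 * K ^ k) <= k.+2 * (M ^ k.+1 * M ^ k.+1).
  rewrite -!expnD.
  have -> : k.+2 + k = (2 * k + 1).+1 by lia.
  have -> : k.+1 + k.+1 = (2 * k + 1).+1 by lia.
  have := expnD_leq M (2 * k.+1) (2 * k + 1); rewrite -/K => hB.
  have hK : k.+2 * ((2 * k + 1).+1 * (2 * k.+1) * K ^ (2 * k + 1)) <= K ^ (2 * k + 1).+1.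
    rewrite [X in _ <= X]expnS !mulnA leq_mul2r; apply/orP; right.
    by rewrite /K /M -mulnn; nia.
  move: hB hK; set e := _ * _ * K ^ _; move: e (K ^ _.+1) (M ^ _.+1) => e u v; nia.
have f0 : 0 < k`! by rewrite fact_gt0.
move: h1 h2 h3; rewrite !factS.
move: 'C(M + k.+1 + k.+1, k.+2) 'C(M + k.+1 + k - 1, k) 'C(M + k.+1, k.+1).
move=> a b c h1 h2 h3.
move: h4 h1 h2 h3; move: (K ^ k.+2) (K ^ k) (M ^ k.+1) => p q r h4 h1 h2 h3.
have h12 := leq_mul h1 h2; have h33 := leq_mul h3 h3.
have f1 : 0 < k.+2 * (k.+1 * k`!) * (k.+1 * k`!) by rewrite !muln_gt0 f0.
rewrite -(leq_pmul2r f1).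
move: f0 h12 h33 h4; move: (k`!) => f f0 h12 h33 h4.
have -> : a * b * (k.+2 * (k.+1 * f) * (k.+1 * f)) =
  k.+1 * (a * (k.+2 * (k.+1 * f)) * (b * f)) by ring.
have -> : c * c * (k.+2 * (k.+1 * f) * (k.+1 * f)) =
  k.+2 * (c * (k.+1 * f) * (c * (k.+1 * f))) by ring.
apply: leq_trans (_ : k.+1 * (p * q) <= _); first by rewrite leq_mul2l h12 orbT.
by apply: leq_trans h4 _; rewrite leq_mul2l h33 orbT.
Qed.

(** * Up-sets of a strict order, their linear extensions and order polynomials *)

Section UpSets.

Variables (T : finType) (lt : rel T).
Hypotheses (lt_irr : irreflexive lt) (lt_trans : transitive lt).
Implicit Types (A B U V S : {set T}) (m u v : T).

Definition minimal_in A m := (m \in A) && [forall v in A, ~~ lt v m].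

Definition upset A := [forall u in A, forall v, lt u v ==> (v \in A)].

Lemma minimal_inP A m :
  reflect (m \in A /\ forall v, v \in A -> ~~ lt v m) (minimal_in A m).
Proof. by apply: (iffP andP) => -[mA /forall_inP]. Qed.

Lemma upsetP A :
  reflect (forall u v, u \in A -> lt u v -> v \in A) (upset A).
Proof.
apply: (iffP forall_inP) => [uA u v /uA/forallP/(_ v)/implyP //|uA u u_in].
by apply/forallP => v; apply/implyP; apply: uA.
Qed.

Lemma minimal_exists A : A != set0 -> exists m, minimal_in A m.
Proof.
case/set0Pn=> u0 u0A.
case: (@arg_minnP _ u0 (mem A) (fun u => #|[set v in A | lt v u]|) u0A) => m mA min_m.
exists m; apply/minimal_inP; split=> // v vA; apply/negP => lt_vm.
have := min_m v vA; rewrite leqNgt => /negP; apply; apply: proper_card.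
apply/properP; split.
  by apply/subsetP => w; rewrite !inE => /andP[-> /lt_trans->].
by exists v; rewrite !inE vA ?lt_vm ?lt_irr.
Qed.

Lemma minimal_setD1 A m u : minimal_in A m -> m != u -> minimal_in (A :\ u) m.
Proof.
move=> /minimal_inP[mA mmin] mu; apply/minimal_inP; split; first by rewrite !inE mu.
by move=> v /setD1P[_ /mmin].
Qed.

Lemma upset0 : upset set0.
Proof. by apply/upsetP => u v; rewrite inE. Qed.

Lemma upset_setD1 A m : upset A -> minimal_in A m -> upset (A :\ m).
Proof.
move=> /upsetP uA /minimal_inP[_ mmin]; apply/upsetP => u v /setD1P[um uInA] uv.
rewrite !inE (uA u) // andbT; apply: contraTneq uv => ->; exact: mmin.
Qed.

Lemma upsetU A B : upset A -> upset B -> upset (A :|: B).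
Proof.
move=> /upsetP uA /upsetP uB; apply/upsetP => u v /setUP[] uin uv.
  by rewrite inE (uA u).
by rewrite inE (uB u) ?orbT.
Qed.

Lemma upsetI A B : upset A -> upset B -> upset (A :&: B).
Proof.
move=> /upsetP uA /upsetP uB; apply/upsetP => u v /setIP[uinA uinB] uv.
by rewrite inE (uA u) // (uB u).
Qed.

(** A minimal element of [A :\: U] is minimal in [A]: an element of [U] below it would force it into
    the up-set [U]. *)
Lemma upset_proper_sub A U : upset U -> U \proper A ->
  exists2 m, minimal_in A m & U \subset A :\ m.
Proof.
move=> /upsetP uU /properP[UA [w wA wU]].
have [|m /minimal_inP[/setDP[mA mU] mmin]] := @minimal_exists (A :\: U).
  by apply/set0Pn; exists w; rewrite inE wU.
exists m; last by rewrite subsetD1 UA.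
apply/minimal_inP; split=> // v vA; have [vU|vU] := boolP (v \in U).
  by apply: contra mU; apply: uU.
by apply: mmin; rewrite inE vU.
Qed.

(** Here [m] is the first element of a linear extension; [k] is fuel for structural recursion, set
    to [#|A|] in [ext_count]. *)
Fixpoint ext_count_rec k A :=
  if k is k'.+1 then \sum_(m | minimal_in A m) ext_count_rec k' (A :\ m) else 1.

Definition ext_count A := ext_count_rec #|A| A.

Lemma ext_count0 : ext_count set0 = 1.
Proof. by rewrite /ext_count cards0. Qed.

Lemma ext_countE A : A != set0 ->
  ext_count A = \sum_(m | minimal_in A m) ext_count (A :\ m).
Proof.
rewrite -card_gt0 /ext_count; case cA: #|A| => [//|k] _ /=.
apply: eq_bigr => m /andP[mA _].
by move: cA; rewrite (cardsD1 m) mA add1n => -[->].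
Qed.

Lemma cardsD1_minimal A m : minimal_in A m -> #|A| = #|A :\ m|.+1.
Proof. by case/andP => mA _; rewrite (cardsD1 m) mA. Qed.

Lemma ext_count_gt0 A : 0 < ext_count A.
Proof.
move: {2}#|A| (erefl #|A|) => n; elim: n A => [|n IHn] A cA.
  by rewrite (eqP (_ : A == set0)) -?cards_eq0 ?cA // ext_count0.
have A0: A != set0 by rewrite -card_gt0 cA.
have [m mA] := minimal_exists A0.
rewrite ext_countE // (bigD1 m) //= ltn_addr // IHn //.
by move: cA; rewrite (cardsD1_minimal mA) => -[].
Qed.

(* The number of order-preserving maps from [A] to a chain of [N] elements;
   [U] is the set of elements not sent to the bottom of the chain. *)
Fixpoint order_poly N A :=
  if N is N'.+1 then \sum_(U : {set T} | U \subset A) (upset U * order_poly N' U)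
  else (A == set0 : nat).

(** Induction on [N]: up-sets are closed under union and intersection, so the summands satisfy the
    hypothesis of [four_functions]. *)
Lemma order_poly_supermodular N A B : upset A -> upset B ->
  order_poly N A * order_poly N B <=
  order_poly N (A :|: B) * order_poly N (A :&: B).
Proof.
elim: N A B => [|N IHN] A B uA uB /=.
  by have [->|] := eqVneq A set0; have [->|//] := eqVneq B set0;
     rewrite ?setU0 ?set0I ?eqxx.
(* The four sums have different ranges; the indicator of [U \subset S] moves them to the common
   range of all subsets. *)
have toE S : \sum_(U : {set T} | U \subset S) upset U * order_poly N U =
  \sum_(U : {set T} | U \subset setT) (U \subset S) * (upset U * order_poly N U).
  rewrite big_mkcond [RHS]big_mkcond; apply: eq_bigr => U _.
  by rewrite subsetT; case: ifP; rewrite ?mul1n.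
rewrite !toE; apply: four_functions => U V _ _.
case UA: (U \subset A) => //; case VB: (V \subset B); last by rewrite mul0n muln0.
rewrite setUSS // setISS // !mul1n.
case uU: (upset U) => //; case uV: (upset V); last by rewrite mul0n muln0.
by rewrite upsetU // upsetI // !mul1n IHN.
Qed.

Lemma order_poly_ge N A : upset A -> 'C(N, #|A|) * ext_count A <= order_poly N A.
Proof.
elim: N A => [|N IHN] A uA.
  by rewrite /= bin0n cards_eq0; case: eqP => // ->; rewrite ext_count0.
rewrite /= (bigD1 A) //= uA mul1n.
have [->|A0] := eqVneq A set0.
  rewrite cards0 bin0 ext_count0 ltn_addr //.
  by have := IHN _ upset0; rewrite cards0 bin0 ext_count0.
have : 0 < #|A| by rewrite card_gt0.
case cA: #|A| => [//|k] _; rewrite binS mulnDl leq_add //; first by rewrite -cA IHN.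
rewrite ext_countE // big_distrr /=.
set F := fun U : {set T} => upset U * order_poly N U.
apply: (@leq_trans (\sum_(m | minimal_in A m) F (A :\ m))).
  apply: leq_sum => m mA; rewrite /F upset_setD1 // mul1n.
  have -> : k = #|A :\ m| by move: cA; rewrite (cardsD1_minimal mA) => -[].
  by rewrite IHN // upset_setD1.
have inj : {in [pred m | minimal_in A m] &, injective (fun m => A :\ m)}.
  move=> m m' /andP[mA _] _ eqm; apply: contraTeq mA => mm'.
  suff : m \notin A :\ m' by rewrite !inE mm'.
  by rewrite -eqm setD11.
rewrite -(big_imset F inj) /= [X in _ <= X]big_mkcond [X in X <= _]big_mkcond /=.
apply: leq_sum => U _; case: ifP => // /imsetP[m mA ->]; case/andP: mA => mA _.
rewrite subD1set /=; case: ifP => // /negbFE/eqP eA.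
by have := setD11 m A; rewrite eA mA.
Qed.

(** Every order-preserving map is weakly increasing along some linear extension, and the binomial
    counts weakly increasing sequences. In the induction on [N] and [#|A|], each up-set [U] properly
    inside [A] lies in some [A :\ m], so these terms are bounded by the sum of
    [order_poly N.+1 (A :\ m)]. *)
Lemma order_poly_le N A : upset A ->
  order_poly N A <= 'C(N + #|A| - 1, #|A|) * ext_count A.
Proof.
elim: N A => [|N IHN] A uA.
  rewrite /=; case: eqP => // ->; by rewrite cards0 bin0 ext_count0.
move: {2}#|A| (erefl #|A|) uA => n; elim: n A => [|n IHn] A cA uA.
  have A0 : A = set0 by apply/eqP; rewrite -cards_eq0 cA.
  have := IHN A uA; rewrite cA !bin0 /= A0.
  rewrite (big_pred1 set0); last by move=> U; rewrite subset0.
  by rewrite upset0 !mul1n.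
have A0: A != set0 by rewrite -card_gt0 cA.
rewrite [order_poly _ _]/= (bigD1 A) //= uA mul1n.
rewrite cA addSn subSS subn0 addnS binS mulnDl leq_add //.
  by have := IHN A uA; rewrite cA addnS subSS subn0.
rewrite ext_countE // big_distrr /=.
apply: (@leq_trans (\sum_(m | minimal_in A m) order_poly N.+1 (A :\ m))); last first.
  apply: leq_sum => m mA.
  have cm : #|A :\ m| = n by move: cA; rewrite (cardsD1_minimal mA) => -[].
  by have := IHn (A :\ m) cm (upset_setD1 uA mA); rewrite cm addSn subSS subn0.
rewrite /= (exchange_big_dep (fun U : {set T} => true)) //=.
rewrite [X in X <= _]big_mkcond; apply: leq_sum => U _.
case: ifP => // /andP[UA neUA]; case uU: (upset U); rewrite ?mul0n //.
have [|m mA Um] := @upset_proper_sub A U uU; first by rewrite properEneq neUA.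
by rewrite (bigD1 m) ?mA //= leq_addr.
Qed.

(** The two bounds on [order_poly] turn its supermodularity into the claim with extra binomial
    factors. Since their limiting ratio is strictly below 1, a single finite [N] from
    [bin_mul_leq_sqr] absorbs them and no limit is taken. *)
Lemma ext_count_supermodular A a b : upset A ->
    minimal_in A a -> minimal_in A b -> a != b ->
  ext_count (A :\ a) * ext_count (A :\ b) <=
  ext_count A * ext_count (A :\ a :\ b).
Proof.
move=> uA mina minb ab.
have mab : minimal_in (A :\ a) b by rewrite minimal_setD1 // eq_sym.
have uAa := upset_setD1 uA mina; have uAb := upset_setD1 uA minb.
have uAab := upset_setD1 uAa mab.
pose k := #|A :\ a :\ b|.
have ca : #|A :\ a| = k.+1 by rewrite (cardsD1_minimal mab).
have cA : #|A| = k.+2 by rewrite (cardsD1_minimal mina) ca.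
have cb : #|A :\ b| = k.+1 by move: cA; rewrite (cardsD1_minimal minb) => -[].
have [N [N0 leN]] := bin_mul_leq_sqr k.
have unionE : (A :\ a) :|: (A :\ b) = A.
  apply/setP => u; rewrite !inE -andb_orl.
  by case: (eqVneq u a) => [->|_]; rewrite ?ab.
have interE : (A :\ a) :&: (A :\ b) = A :\ a :\ b.
  by apply/setP => u; rewrite !inE andbACA andbb -andbA andbCA.
have := order_poly_supermodular N uAa uAb; rewrite unionE interE => sup.
have := leq_mul (order_poly_ge N uAa) (order_poly_ge N uAb).
move=> /leq_trans/(_ sup)/leq_trans.
move=> /(_ _ (leq_mul (order_poly_le N uA) (order_poly_le N uAab))).
rewrite ca cb cA -/k mulnACA [X in _ <= X]mulnACA => le1.
have le2 := leq_mul leN (leqnn (ext_count A * ext_count (A :\ a :\ b))).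
move: le1; rewrite addnS subSS subn0 => /leq_trans/(_ le2).
by rewrite leq_pmul2l // muln_gt0 N0.
Qed.

(** * Linear extensions as sequences, and sums over the position of [x] *)

Fixpoint ext_seqs_rec k A : seq (seq T) :=
  if k is k'.+1 then
    [seq m :: s | m <- enum (minimal_in A), s <- ext_seqs_rec k' (A :\ m)]
  else [:: [::]].

Definition ext_seqs A := ext_seqs_rec #|A| A.

Lemma ext_seqsE A : A != set0 ->
  ext_seqs A = [seq m :: s | m <- enum (minimal_in A), s <- ext_seqs (A :\ m)].
Proof.
rewrite -card_gt0 /ext_seqs; case cA: #|A| => [//|k] _ /=.
congr flatten; apply/eq_in_map => m; rewrite mem_enum => /andP[mA _].
by move: cA; rewrite (cardsD1 m) mA add1n => -[->].
Qed.

Lemma ext_seqs0 : ext_seqs set0 = [:: [::]].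
Proof. by rewrite /ext_seqs cards0. Qed.

Lemma sum_ext_seqs (F : seq T -> nat) A : A != set0 ->
  \sum_(s <- ext_seqs A) F s =
  \sum_(m | minimal_in A m) \sum_(s <- ext_seqs (A :\ m)) F (m :: s).
Proof. by move=> A0; rewrite ext_seqsE // big_allpairs_dep big_enum. Qed.

Lemma ext_seqs_sum1 A : \sum_(s <- ext_seqs A) 1 = ext_count A.
Proof.
move: {2}#|A| (erefl #|A|) => n; elim: n A => [|n IHn] A cA.
  by rewrite (eqP (_ : A == set0)) -?cards_eq0 ?cA // ext_seqs0 ext_count0 big_seq1.
have A0: A != set0 by rewrite -card_gt0 cA.
rewrite sum_ext_seqs // ext_countE //; apply: eq_bigr => m mA.
by apply: IHn; move: cA; rewrite (cardsD1_minimal mA) => -[].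
Qed.

(** This non-recursive form is what allows the comparison with [linear_extensions]. *)
Lemma mem_ext_seqs A s :
  (s \in ext_seqs A) =
  [&& uniq s, [set:: s] == A & pairwise (fun u v => ~~ lt v u) s].
Proof.
elim: s A => [|m s IHs] A; have [->|A0] := eqVneq A set0.
- by rewrite ext_seqs0.
- rewrite ext_seqsE //=.
  by apply/negP => /allpairsPdep[m [s [_ _]]].
- rewrite ext_seqs0 inE /=; apply/esym/negP => /and3P[_ /eqP/setP/(_ m)].
  by rewrite !inE eqxx.
rewrite ext_seqsE //; apply/allpairsPdep/idP => [[m' [s' [mA sA [em es]]]]|].
  subst m' s'; move: mA sA; rewrite mem_enum IHs => /minimal_inP[mA mmin].
  case/and3P=> us /eqP eqs ps; rewrite /= us ps andbT.
  have ms : m \notin s by have := setD11 m A; rewrite -eqs inE => ->.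
  rewrite ms set_cons eqs setD1K // eqxx /= andbT.
  apply/allP => v vs; apply: mmin.
  suff : v \in A :\ m by case/setD1P.
  by rewrite -eqs inE.
rewrite /= => /and3P[/andP[ms us] /eqP eqA /andP[/allP allm ps]].
have eqs : [set:: s] = A :\ m.
  by rewrite -eqA set_cons setU1K // inE.
exists m, s; split=> //; last by rewrite IHs us eqs eqxx.
rewrite mem_enum; apply/minimal_inP; split; first by rewrite -eqA !inE eqxx.
move=> v; rewrite -eqA !inE => /orP[/eqP->|]; last exact: allm.
by rewrite lt_irr.
Qed.

Lemma ext_seqs_uniq A : uniq (ext_seqs A).
Proof.
move: {2}#|A| (erefl #|A|) => n; elim: n A => [|n IHn] A cA.
  by rewrite (eqP (_ : A == set0)) -?cards_eq0 ?cA // ext_seqs0.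
have A0: A != set0 by rewrite -card_gt0 cA.
rewrite ext_seqsE //; apply: allpairs_uniq_dep; first exact: enum_uniq.
  move=> m; rewrite mem_enum => mA.
  by apply: IHn; move: cA; rewrite (cardsD1_minimal mA) => -[].
by move=> [m s] [m' s'] /= _ _ [-> ->].
Qed.

Variable x : T.

(** These are [h(A)] and, next, [g(A)]; [index] starts at 0, hence the successors. *)
Definition pos_sum A := \sum_(s <- ext_seqs A) (index x s).+1.
Definition pos_sum2 A := \sum_(s <- ext_seqs A) 'C((index x s).+2, 2).

(** The first entry contributes 1 to the position of [x]; when it is not [x], the rest is the
    position of [x] in the tail. *)
Lemma pos_sumE A : x \in A ->
  pos_sum A =
  ext_count A + \sum_(m | minimal_in A m && (m != x)) pos_sum (A :\ m).
Proof.
move=> xA; have A0 : A != set0 by apply/set0Pn; exists x.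
rewrite /pos_sum -ext_seqs_sum1 !sum_ext_seqs // [X in _ = _ + X]big_mkcondr /= -big_split /=.
apply: eq_bigr => m _; rewrite [m == x]eq_sym.
rewrite (_ : (if _ then _ else _) = \sum_(s <- ext_seqs (A :\ m))
    (if x != m then (index x s).+1 else 0)); last by case: ifP; rewrite ?big1_eq.
rewrite -big_split; apply: eq_bigr => s _ /=.
by rewrite eq_sym; case: eqP.
Qed.

(** Pascal's rule: a position [p] gives ['C(p+1, 2) = p + 'C(p, 2)], and ['C(p, 2)] is the
    contribution of the tail, where [x] has position [p - 1]. *)
Lemma pos_sum2E A : x \in A ->
  pos_sum2 A =
  pos_sum A + \sum_(m | minimal_in A m && (m != x)) pos_sum2 (A :\ m).
Proof.
move=> xA; have A0 : A != set0 by apply/set0Pn; exists x.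
rewrite /pos_sum /pos_sum2 !sum_ext_seqs // [X in _ = _ + X]big_mkcondr /= -big_split /=.
apply: eq_bigr => m _; rewrite [m == x]eq_sym.
rewrite (_ : (if _ then _ else _) = \sum_(s <- ext_seqs (A :\ m))
    (if x != m then 'C((index x s).+2, 2) else 0)); last by case: ifP; rewrite ?big1_eq.
rewrite -big_split; apply: eq_bigr => s _ /=.
by rewrite eq_sym; case: eqP => //= _; rewrite binS bin1 addnC.
Qed.

End UpSets.

(** * Adjoining an element below [x], and the second-moment bound on up-sets *)

Section AddedElement.

Variables (T : finType) (lt : rel T).
Hypotheses (lt_irr : irreflexive lt) (lt_trans : transitive lt).
Variable x : T.
Implicit Types (A B : {set T}) (m u v : T).

(* [None] is a new minimal element placed below [x]. *)
Definition lt_below : rel (option T) := fun p q =>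
  match p, q with
  | Some u, Some v => lt u v
  | None, Some v => (x == v) || lt x v
  | _, None => false
  end.

Lemma lt_below_irr : irreflexive lt_below.
Proof. by case=> [u|] //=; rewrite lt_irr. Qed.

Lemma lt_below_trans : transitive lt_below.
Proof.
case=> [v|] [u|] [w|] //=; first exact: lt_trans.
by case/orP => [/eqP<- ->|/lt_trans xv /xv ->]; rewrite orbT.
Qed.

Lemma big_option (P : pred (option T)) (F : option T -> nat) :
  \sum_(p | P p) F p =
  (if P None then F None else 0) + \sum_(u | P (Some u)) F (Some u).
Proof.
rewrite big_mkcond (bigD1 None) //= [in RHS]big_mkcond; congr (_ + _).
rewrite (reindex_omap Some id) /=; last by case.
by apply: eq_bigl => u; rewrite eqxx.
Qed.

Definition with_new A : {set option T} := None |: Some @: A.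

Lemma mem_Some A u : (Some u \in Some @: A) = (u \in A).
Proof. by rewrite mem_imset //; apply: Some_inj. Qed.

Lemma None_notin A : None \notin Some @: A.
Proof. by apply/imsetP => -[]. Qed.

Lemma Some_setD1 A m : (Some @: A) :\ Some m = Some @: (A :\ m).
Proof.
apply/setP=> -[u|]; rewrite !inE ?mem_Some ?inE //.
by rewrite !(negPf (None_notin _)).
Qed.

Lemma with_new_setD1 A m : with_new A :\ Some m = with_new (A :\ m).
Proof.
apply/setP=> -[u|]; rewrite !inE ?mem_Some ?inE //.
Qed.

Lemma with_new_None A : with_new A :\ None = Some @: A.
Proof. by rewrite setU1K // None_notin. Qed.

Lemma minimal_Some A m :
  minimal_in lt_below (Some @: A) (Some m) = minimal_in lt A m.
Proof.
apply/minimal_inP/minimal_inP; rewrite mem_Some => -[mA mmin]; split=> // v.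
  by move=> vA; apply: (mmin (Some v)); rewrite mem_Some.
by case: v => [v|]; [rewrite mem_Some; apply: mmin|rewrite (negPf (None_notin A))].
Qed.

Lemma minimal_with_new A m : x \in A ->
  minimal_in lt_below (with_new A) (Some m) = minimal_in lt A m && (m != x).
Proof.
move=> xA; apply/minimal_inP/andP; rewrite !inE mem_Some /=.
  move=> [mA mmin]; split.
    apply/minimal_inP; split=> // v vA.
    by apply: (mmin (Some v)); rewrite !inE mem_Some.
  by have := mmin None; rewrite !inE eqxx eq_sym => /(_ isT) /norP[].
move=> [/minimal_inP[mA mmin] mx]; split=> // -[v|]; rewrite !inE ?mem_Some /=.
  exact: mmin.
by rewrite eq_sym (negPf mx) mmin.
Qed.

Lemma minimal_None A : minimal_in lt_below (with_new A) None.
Proof. by apply/minimal_inP; split=> [|[]//]; rewrite !inE. Qed.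

Lemma ext_count_Some A : ext_count lt_below (Some @: A) = ext_count lt A.
Proof.
move: {2}#|A| (erefl #|A|) => n; elim: n A => [|n IHn] A cA.
  by rewrite (eqP (_ : A == set0)) -?cards_eq0 ?cA // imset0 !ext_count0.
have A0: A != set0 by rewrite -card_gt0 cA.
rewrite !ext_countE ?imset_eq0 // big_option /minimal_in (negPf (None_notin A)) /=.
apply: eq_big => m; first exact: minimal_Some.
rewrite -/(minimal_in _ _ _) minimal_Some => mA; rewrite Some_setD1; apply: IHn.
by move: cA; rewrite (cardsD1_minimal mA) => -[].
Qed.

(** The new element has as many slots as the position of [x]. Formally both sides obey one
    recursion: [None] first leaves [A], and [x] cannot come first. *)
Lemma ext_count_with_new A : x \in A ->
  ext_count lt_below (with_new A) = pos_sum lt x A.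
Proof.
move: {2}#|A| (erefl #|A|) => n; elim: n A => [|n IHn] A cA xA.
  by move: cA xA => /eqP; rewrite cards_eq0 => /eqP->; rewrite inE.
have A0 : with_new A != set0 by apply/set0Pn; exists None; rewrite !inE.
rewrite pos_sumE // ext_countE // big_option minimal_None with_new_None.
rewrite ext_count_Some; congr (_ + _).
apply: eq_big => m; rewrite minimal_with_new // => /andP[mA mx].
rewrite with_new_setD1 IHn //; last by rewrite !inE eq_sym mx.
by move: cA; rewrite (cardsD1_minimal mA) => -[].
Qed.

Lemma upset_with_new A : x \in A -> upset lt A -> upset lt_below (with_new A).
Proof.
move=> xA /upsetP uA; apply/upsetP => -[u|] [v|]; rewrite !inE ?mem_Some //=.
  exact: uA.
by move=> _ /orP[/eqP<- //|]; apply: uA.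
Qed.

(** This is [ext_count_supermodular] for [with_new A] with [Some m] and [None] deleted;
    cross-multiplied, it says that deleting [m] does not increase the mean position of [x]. *)
Lemma pos_sum_setD1 A m : upset lt A -> x \in A -> minimal_in lt A m -> m != x ->
  pos_sum lt x (A :\ m) * ext_count lt A <=
  pos_sum lt x A * ext_count lt (A :\ m).
Proof.
move=> uA xA mA mx.
have xAm : x \in A :\ m by rewrite !inE eq_sym mx.
have := @ext_count_supermodular _ lt_below lt_below_irr lt_below_trans
  (with_new A) (Some m) None (upset_with_new xA uA).
rewrite minimal_with_new // mA mx => /(_ isT (minimal_None A) isT).
by rewrite with_new_setD1 !with_new_None !ext_count_Some !ext_count_with_new.
Qed.

Lemma pos_sum2_leq A : upset lt A -> x \in A ->
  pos_sum2 lt x A * ext_count lt A <= pos_sum lt x A ^ 2.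
Proof.
move: {2}#|A| (erefl #|A|) => n; elim: n A => [|n IHn] A cA uA xA.
  by move: cA xA => /eqP; rewrite cards_eq0 => /eqP->; rewrite inE.
(* Expanding [g(A)] on the left and one factor [h(A)] on the right, the common term [h(A) e(A)]
   cancels; [g(A - m) e(A) <= h(A) h(A - m)] remains for each [m]. *)
rewrite pos_sum2E // mulnDl -mulnn [X in _ <= _ * X]pos_sumE // mulnDr leq_add2l.
rewrite big_distrl big_distrr /=; apply: leq_sum => m /andP[mA mx].
have xAm : x \in A :\ m by rewrite !inE eq_sym mx.
have cm : #|A :\ m| = n by move: cA; rewrite (cardsD1_minimal mA) => -[].
have le1 := IHn _ cm (upset_setD1 uA mA) xAm.
have le2 := pos_sum_setD1 uA xA mA mx.
have e0 := ext_count_gt0 lt_irr lt_trans (A :\ m).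
(* After multiplication by [e(A - m) > 0]: [g(A - m) e(A - m) e(A) <= h(A - m)^2 e(A) <= h(A - m)
   h(A) e(A - m)]. *)
rewrite -(leq_pmul2r e0) mulnAC (leq_trans (leq_mul le1 (leqnn _))) //.
by rewrite -mulnn -mulnA [X in _ <= X]mulnAC [X in _ <= X]mulnC leq_mul2l le2 orbT.
Qed.

End AddedElement.

(** * Transfer from sequences to [linear_extensions] *)

Section LinearExtensions.

Variables (d : Order.disp_t) (X : finPOrderType d).
Implicit Types (s : seq X) (u v x y : X).

Let ltX : rel X := fun u v => (u < v)%O.

Lemma ltX_irr : irreflexive ltX.
Proof. by move=> u; rewrite /ltX Order.POrderTheory.ltxx. Qed.

Lemma ltX_trans : transitive ltX.
Proof. exact: Order.POrderTheory.lt_trans. Qed.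

Lemma index_ltn_card s u : uniq s -> [set:: s] = setT -> index u s < #|X|.
Proof.
move=> us eqs; have mem_s v : v \in s by have := in_setT v; rewrite -eqs inE.
rewrite -cardsT -eqs cardsE (card_uniqP us).
by rewrite index_mem.
Qed.

(** The default [i0] is a parameter because ['I_#|X|] is empty when [X] is; on a sequence listing
    all of [X] the index is always in range. *)
Definition ext_of_seq (i0 : 'I_#|X|) s : {ffun X -> 'I_#|X|} :=
  [ffun u => insubd i0 (index u s)].

Lemma ext_of_seqE i0 s u : s \in ext_seqs ltX setT ->
  ext_of_seq i0 s u = index u s :> nat.
Proof.
rewrite (mem_ext_seqs ltX_irr) => /and3P[us /eqP eqs _].
by rewrite ffunE val_insubd index_ltn_card.
Qed.

Lemma mem_linear_extensions i0 (g : {ffun X -> 'I_#|X|}) :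
  (g \in linear_extensions X) =
  (g \in [seq ext_of_seq i0 s | s <- ext_seqs ltX setT]).
Proof.
rewrite inE; apply/and3P/mapP => [[/injectiveP g_inj _ /forallP g_mono]|].
  have [g' gK g'K] : bijective g by apply: inj_card_bij => //; rewrite card_ord.
  (* The elements of [X] in increasing order of their value under [g], so that [index] recovers
     [g]. *)
  pose s := [seq g' i | i <- enum 'I_#|X|].
  have index_s u : index u s = g u.
    by rewrite -{1}(gK u) index_map ?index_enum_ord //; apply: can_inj g'K.
  have s_in : s \in ext_seqs ltX setT.
    rewrite (mem_ext_seqs ltX_irr); apply/and3P; split.
    - by rewrite map_inj_uniq ?enum_uniq //; apply: can_inj g'K.
    - by apply/eqP/setP => u; rewrite !inE -(gK u) map_f // mem_enum.
    - rewrite /s pairwise_map; apply/(pairwiseP i0) => i j; rewrite !inE size_enum_ord.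
      move=> ltin ltjn ltij /=; apply/negP => lt_ji.
      have := g_mono (g' (nth i0 (enum 'I_#|X|) j)) => /forallP/(_ (g' (nth i0 (enum 'I_#|X|) i))).
      by move/implyP => /(_ lt_ji); rewrite !g'K !nth_enum_ord // ltnNge ltnW.
  exists s => //; apply/ffunP => u; apply: val_inj.
  by rewrite /= ext_of_seqE.
case=> s s_in ->; have := s_in; rewrite (mem_ext_seqs ltX_irr) => /and3P[us /eqP eqs ps].
have mem_s v : v \in s by have := in_setT v; rewrite -eqs inE.
have size_s : size s = #|X| by rewrite -cardsT -eqs cardsE (card_uniqP us).
split.
- apply/injectiveP => u v /(congr1 val) /=; rewrite !ext_of_seqE // => euv.
  by rewrite -(nth_index u (mem_s u)) euv nth_index.
- apply/forallP => i; have iX : i < size s by rewrite size_s.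
  have x0 : X by move: iX; case: (s) => // x0.
  apply/existsP; exists (nth x0 s i); apply/eqP/val_inj.
  by rewrite /= ext_of_seqE // index_uniq.
apply/forallP => u; apply/forallP => v; apply/implyP => uv.
rewrite !ext_of_seqE // ltnNge leq_eqVlt; apply/negP => /orP[/eqP eq_vu|lt_vu].
  have := nth_index u (mem_s u); rewrite -eq_vu nth_index // => eq_vu'.
  by move: uv; rewrite eq_vu' Order.POrderTheory.ltxx.
have /(pairwiseP u)/(_ (index v s) (index u s)) := ps.
rewrite !inE !index_mem !nth_index // => /(_ (mem_s v) (mem_s u) lt_vu).
by rewrite /ltX uv.
Qed.

Lemma sum_linear_extensions (F : nat -> nat) x :
  \sum_(g in linear_extensions X) F (g x) =
  \sum_(s <- ext_seqs ltX setT) F (index x s).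
Proof.
pose i0 := enum_rank x.
rewrite -big_enum /= (perm_big [seq ext_of_seq i0 s | s <- ext_seqs ltX setT]) /=.
  by rewrite big_map [LHS]big_seq [RHS]big_seq; apply: eq_bigr => s s_in; rewrite ext_of_seqE.
apply: uniq_perm; first exact: enum_uniq.
  (* Two duplicate-free listings of [X] with the same index function agree entry by entry. *)
  rewrite map_inj_in_uniq ?ext_seqs_uniq // => s t s_in t_in /ffunP eq_st.
  have eq_index u : index u s = index u t.
    by rewrite -(ext_of_seqE i0 u s_in) eq_st ext_of_seqE.
  move: s_in t_in; rewrite !(mem_ext_seqs ltX_irr).
  move=> /and3P[us /eqP eqs _] /and3P[ut /eqP eqt _].
  have size_st : size s = size t.
    rewrite -(card_uniqP us) -(card_uniqP ut); apply: eq_card => u.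
    by have /setP/(_ u) := etrans eqs (esym eqt); rewrite !inE.
  apply: (@eq_from_nth _ x) => // i i_s.
  have mem_t : nth x s i \in t by have := in_setT (nth x s i); rewrite -eqt inE.
  by have := nth_index x mem_t; rewrite -eq_index index_uniq.
by move=> g; rewrite mem_enum (mem_linear_extensions i0).
Qed.

Lemma sum_lext_val_binomial x :
  (\sum_(g in linear_extensions X) 'C((lext_val g x).+1, 2))
    * #|linear_extensions X|
  <= (\sum_(g in linear_extensions X) lext_val g x) ^ 2.
Proof.
rewrite -sum1_card (sum_linear_extensions (fun=> 1) x).
rewrite (sum_linear_extensions (fun i => 'C(i.+2, 2)) x).
rewrite (sum_linear_extensions succn x) ext_seqs_sum1.
apply: pos_sum2_leq; rewrite ?inE //; first exact: ltX_irr.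
  exact: ltX_trans.
by apply/upsetP => u v; rewrite !inE.
Qed.

End LinearExtensions.

(** * The pointwise inequality and the passage to expectations *)

Import Order.TTheory GRing.Theory Num.Theory.
Local Open Scope ring_scope.

(** With [m = minn a b], twice the right side minus twice the left side is [(v a - u b)^2 + v^2 (a -
    m) + u^2 (b - m) + (u - v)^2 m], a sum of nonnegative terms. *)
Lemma mul_min_weighted_AMGM (R : realFieldType) (a b : nat) (u v : R) :
  0 <= u -> 0 <= v ->
  u * v * (a%:R * b%:R + (minn a b)%:R) <=
  v ^+ 2 * 'C(a.+1, 2)%:R + u ^+ 2 * 'C(b.+1, 2)%:R.
Proof.
move=> u0 v0.
have binE c : 2 * 'C(c.+1, 2)%:R = c%:R * (c%:R + 1) :> R.
  by rewrite -natrM -mul_bin_diag bin1 natrM mulrC -natr1.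
have ea := congr1 ( *%R (v ^+ 2)) (binE a).
have eb := congr1 ( *%R (u ^+ 2)) (binE b).
have ma : (minn a b)%:R <= a%:R :> R by rewrite ler_nat geq_minl.
have mb : (minn a b)%:R <= b%:R :> R by rewrite ler_nat geq_minr.
have m0 : 0 <= (minn a b)%:R :> R by [].
move: ma mb m0 ea eb {binE}; move: (minn a b)%:R a%:R b%:R => m p q ma mb m0.
move: ('C(a.+1, 2))%:R ('C(b.+1, 2))%:R => A B /= ea eb.
have h1 : 0 <= v ^+ 2 * (p - m) by rewrite mulr_ge0 ?sqr_ge0 ?subr_ge0.
have h2 : 0 <= u ^+ 2 * (q - m) by rewrite mulr_ge0 ?sqr_ge0 ?subr_ge0.
have h3 : 0 <= (u - v) ^+ 2 * m by rewrite mulr_ge0 ?sqr_ge0.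
have h4 := sqr_ge0 (v * p - u * q).
lra.
Qed.

Theorem theorem1p2 (R : realFieldType) (d : Order.disp_t)
    (X : finPOrderType d) (x y : X) :
  (lext_expect (fun f => (lext_val f x)%:R * (lext_val f y)%:R : R)
   + lext_expect (fun f => (minn (lext_val f x) (lext_val f y))%:R : R))
  / (lext_expect (fun f => (lext_val f x)%:R : R)
     * lext_expect (fun f => (lext_val f y)%:R : R))
  <= 2.
Proof.
rewrite /lext_expect; set N : R := #|_|%:R.
rewrite -mulrDl -big_split /=.
set S := \sum_(g in _) _.
pose h z : R := \sum_(g in linear_extensions X) (lext_val g z)%:R.
pose c z : R := \sum_(g in linear_extensions X) 'C((lext_val g z).+1, 2)%:R.
rewrite -/(h x) -/(h y).
(* For [N = 0] the convention [0^-1 = 0] makes the left side 0, so the existence of a linear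
   extension need not be shown. *)
have [N0|N_neq0] := eqVneq N 0.
  by rewrite N0 invr0 !mulr0 invr0 mulr0.
have N_gt0 : 0 < N by rewrite lt_def N_neq0 ler0n.
have cN z : c z * N <= h z ^+ 2.
  by rewrite /c /h /N -!natr_sum -natrM -natrX ler_nat sum_lext_val_binomial.
have h_gt0 z : 0 < h z.
  apply: lt_le_trans N_gt0 _; rewrite /N /h -natr_sum ler_nat -sum1_card.
  exact: leq_sum.
have hx := h_gt0 x; have hy := h_gt0 y.
(* The weights are the sums [h x] and [h y] instead of the expectations; the inequality is
   homogeneous in them. *)
have le_S : h x * h y * S <= h y ^+ 2 * c x + h x ^+ 2 * c y.
  move: (ltW hx) (ltW hy); move: (h x) (h y) => u v u0 v0.
  rewrite /S /c !mulr_sumr -big_split /=; apply: ler_sum => g _.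
  exact: mul_min_weighted_AMGM.
(* Multiplied by [h x * h y], the left side is at most [h y ^+ 2 * (c x * N) + h x ^+ 2 * (c y *
   N)], and [cN] bounds each term by [(h x * h y) ^+ 2]. *)
have le_SN : S * N <= 2 * (h x * h y).
  rewrite -(ler_pM2l (mulr_gt0 hx hy)) [X in X <= _]mulrA.
  apply: le_trans (ler_wpM2r (ltW N_gt0) le_S) _.
  have := ler_wpM2l (sqr_ge0 (h y)) (cN x).
  have := ler_wpM2l (sqr_ge0 (h x)) (cN y).
  by move: (h x) (h y) (c x) (c y) (N) => *; lra.
have -> : S / N / (h x / N * (h y / N)) = S * N / (h x * h y).
  by field; rewrite N_neq0 !gt_eqF.
by rewrite ler_pdivrMr ?mulr_gt0.
Qed.
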